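(* Let $(S,\cdot,\ast)$ be a regular $\star$-semigroup. Define binary operations $+$ and $\oplus$ on $S$ by $a+b=ab$ and $a\oplus b=ba$ for all $a,b\in S$. Then: - for $(S,+,\cdot,\ast)$ the following are equivalent: it is a left regular $\star$-semibrace; it is a right regular $\star$-semibrace; it is a two-sided regular $\star$-semibrace; $(S,\cdot,\ast)$ is completely regular, orthodox and locally inverse; - for $(S,\oplus,\cdot,\ast)$ the following are equivalent: it is a left regular $\star$-semibrace; it is a right regular $\star$-semibrace; it is a two-sided regular $\star$-semibrace; $(S,\cdot,\ast)$ is completely regular, orthodox and locally inverse.
   Context: A regular $\star$-semigroup is a triple $(S,\cdot,\ast)$ where $(S,\cdot)$ is a semigroup on a non-empty set and $\ast:S\to S$, $x\mapsto x^\ast$, satisfies $xx^\ast x=x$, $(x^\ast)^\ast=x$, $(xy)^\ast=y^\ast x^\ast$ for all $x,y\in S$. It is called completely regular if $a\,\mathcal H\,a^2$ for all $a\in S$ ($\mathcal H=\mathcal L\cap\mathcal R$ being Green's relation), orthodox if the product of any two idempotents is idempotent, and locally inverse if $eSe$ is an inverse semigroup for every idempotent $e$. Let $(S,+,\cdot,\ast)$ be such that $(S,+)$ is a semigroup and $(S,\cdot,\ast)$ is a regular $\star$-semigroup. It is a left regular $\star$-semibrace if $x(y+z)=xy+x(x^{\ast}+z)$ for all $x,y,z\in S$; a right regular $\star$-semibrace if $(z+y)x=(z+x^{\ast})x+yx$ for all $x,y,z\in S$; two-sided if both hold. Multiplication has precedence over addition. The same terminology is used with $\oplus$ in place of $+$.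 *)

(* Defs.v *)
From mathcomp Require Import all_boot.

Set Implicit Arguments.
Unset Strict Implicit.
Unset Printing Implicit Defensive.

(* The semigroup notions are predicates on unbundled operations over a bare
   [Type]: two multiplications live on the same carrier, and MathComp's
   [semigroupType] would additionally require a [choiceType] carrier. *)

Record semigroup (S : Type) (op : S -> S -> S) : Prop := {
  semigroup_nonempty : inhabited S;
  semigroup_assoc : associative op
}.

Record regular_star_semigroup (S : Type) (mul : S -> S -> S) (star : S -> S)
    : Prop := {
  rss_semigroup : semigroup mul;
  rss_regular : forall x, mul (mul x (star x)) x = x;
  rss_involutive : forall x, star (star x) = x;
  rss_antimorphism : forall x y, star (mul x y) = mul (star y) (star x)
}.

Section SemigroupNotions.
Variables (S : Type) (mul : S -> S -> S).
Local Notation "x * y" := (mul x y).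

(* Membership in S^1 a and a S^1, with S^1 the semigroup S with an identity
   adjoined. *)
Definition principal_left_ideal (a x : S) : Prop :=
  x = a \/ exists s, x = s * a.
Definition principal_right_ideal (a x : S) : Prop :=
  x = a \/ exists s, x = a * s.

Definition green_L (a b : S) : Prop :=
  forall x, principal_left_ideal a x <-> principal_left_ideal b x.
Definition green_R (a b : S) : Prop :=
  forall x, principal_right_ideal a x <-> principal_right_ideal b x.
Definition green_H (a b : S) : Prop := green_L a b /\ green_R a b.

Definition completely_regular : Prop := forall a, green_H a (a * a).

Definition idempotent_elt (e : S) : Prop := e * e = e.

Definition orthodox : Prop :=
  forall e f, idempotent_elt e -> idempotent_elt f -> idempotent_elt (e * f).

Definition semigroup_inverse (x y : S) : Prop :=
  x * y * x = x /\ y * x * y = y.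

(* The subset A is an inverse semigroup under the restriction of mul;
   associativity is inherited from S. *)
Record inverse_subsemigroup (A : S -> Prop) : Prop := {
  inverse_sub_nonempty : exists x, A x;
  inverse_sub_closed : forall x y, A x -> A y -> A (x * y);
  inverse_sub_inverse :
    forall x, A x -> exists! y, A y /\ semigroup_inverse x y
}.

Definition local_submonoid (e x : S) : Prop := exists s, x = e * s * e.

Definition locally_inverse : Prop :=
  forall e, idempotent_elt e -> inverse_subsemigroup (local_submonoid e).

End SemigroupNotions.

Section Semibraces.
Variables (S : Type) (add mul : S -> S -> S) (star : S -> S).
Local Notation "x + y" := (add x y).
Local Notation "x * y" := (mul x y).

Record left_regular_star_semibrace : Prop := {
  left_semibrace_add : semigroup add;
  left_semibrace_mul : regular_star_semigroup mul star;
  left_semibrace_law :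
    forall x y z, x * (y + z) = x * y + x * (star x + z)
}.

Record right_regular_star_semibrace : Prop := {
  right_semibrace_add : semigroup add;
  right_semibrace_mul : regular_star_semigroup mul star;
  right_semibrace_law :
    forall x y z, (z + y) * x = (z + star x) * x + y * x
}.

Definition two_sided_regular_star_semibrace : Prop :=
  left_regular_star_semibrace /\ right_regular_star_semibrace.

End Semibraces.

(* Main.v *)
(* Each of the four semibrace laws unfolds to a semigroup identity, equivalent
   to: e y z = e y e z for every projection e = x x^*.  (Applying the involution
   turns this into z y e = z e y e.)  Since an idempotent e is the product of
   the projections e e^* and e^* e, the identity then holds for all idempotents
   e, whence orthodoxy and commuting idempotents in each local submonoid;
   complete regularity follows from a = a a^* a = a a^* (a^* a) a.
   Conversely, let h be the idempotent of the group H-class of e y, so that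
   e h = h, and let g = z z^*.  Commutation of idempotents in the local
   submonoids at e, g and h forces h g = h e g, so
   e y z = (e y) h g z = (e y) h e g z = e y e z. *)
Require Import Defs.
From Stdlib Require Import Setoid.
From mathcomp Require Import all_boot.

Set Implicit Arguments.
Unset Strict Implicit.
Unset Printing Implicit Defensive.

(** * Idempotents under orthodoxy, local inverseness or complete regularity *)

Section Orthogroups.
Variables (S : Type) (mul : S -> S -> S).
Hypothesis mulA : associative mul.
Local Notation "x * y" := (mul x y).
Local Notation idem := (idempotent_elt mul).

Lemma orthodox_idem_sandwich e u :
  orthodox mul -> idem e -> idem u -> idem (e * u * e).
Proof. by move=> orth Ie Iu; exact: (orth) (orth _ _ Ie Iu) Ie. Qed.

(** With [p = e * u * e] and [q = e * v * e], both [p * q] and [q * p] are inverses of [p * q] in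
    the local submonoid at [e], so uniqueness of inverses equates them. *)
Lemma locally_inverse_comm e u v :
  orthodox mul -> locally_inverse mul -> idem e -> idem u -> idem v ->
  e * u * e * v * e = e * v * e * u * e.
Proof.
move=> orth linv Ie Iu Iv.
have [_ clos inv] := linv e Ie.
have Ip := orthodox_idem_sandwich orth Ie Iu.
have Iq := orthodox_idem_sandwich orth Ie Iv.
set p := e * u * e in Ip; set q := e * v * e in Iq.
have pl : local_submonoid mul e p by exists u.
have ql : local_submonoid mul e q by exists v.
have pq_inv a b : idem a -> idem b -> semigroup_inverse mul (a * b) (b * a).
  move=> Ia Ib; have := orth _ _ Ia Ib; have := orth _ _ Ib Ia.
  rewrite /idempotent_elt !mulA => Iba Iab; rewrite /semigroup_inverse !mulA.
  rewrite -(mulA a b b) Ib -(mulA (a * b) a a) Ia Iab.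
  by rewrite -(mulA b a a) Ia -(mulA (b * a) b b) Ib Iba.
have [w [_ w_uniq]] := inv _ (clos _ _ pl ql).
have Ipq := orth _ _ Ip Iq.
have pq_qp : p * q = q * p.
  rewrite -(w_uniq (q * p)); last by split; [apply: clos | apply: pq_inv].
  rewrite -(w_uniq (p * q)) //; split; first exact: clos.
  by rewrite /semigroup_inverse Ipq.
have eeK x : x * e * e = x * e by rewrite -mulA Ie.
by move: pq_qp; rewrite /p /q !mulA !eeK.
Qed.

Lemma orthodox_locally_inverse_insert e h g :
  orthodox mul -> locally_inverse mul -> idem e -> idem h -> idem g ->
  e * h = h -> h * g = h * e * g.
Proof.
move=> orth linv Ie Ih Ig eh.
have comm a b c := @locally_inverse_comm a b c orth linv.
have bandK a b : idem a -> idem b -> a * b * a * b = a * b.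
  by move=> Ia Ib; have := orth _ _ Ia Ib; rewrite /idempotent_elt !mulA.
have ehK x : x * e * h = x * h by rewrite -mulA eh.
have hhK x : x * h * h = x * h by rewrite -mulA Ih.
have Ihe : idem (h * e) := orth _ _ Ih Ie.
have gegh : g * e * g * h = g * h.
  by have := congr1 (mul^~ h) (bandK g e Ig Ie); rewrite /= !ehK.
(* Commutation at [e], multiplied on the right by [h] and collapsed by [e * h = h]. *)
have hegh : h * e * g * h = e * g * h.
  have := congr1 (mul^~ h) (comm e h g Ie Ih Ig).
  by rewrite /= eh !ehK hhK.
(* Commutation at [h] of [g] with the idempotent [e * g]. *)
have hgegh : h * g * e * g * h = h * e * g * h.
  have := comm h g (e * g) Ih Ig (orth _ _ Ie Ig).
  rewrite !mulA.
  have -> : h * g * h * e * g * h = h * g * e * g * h.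
    by rewrite -!mulA; congr (_ * (_ * _)); rewrite !mulA hegh.
  move=> ->; rewrite -!mulA; congr (_ * (_ * _)); rewrite !mulA.
  exact: bandK.
have hgh : h * g * h = h * e * g * h.
  by rewrite -hgegh -!mulA; congr (_ * _); rewrite !mulA gegh.
have heg_idem : h * e * g * h * e * g = h * e * g.
  by have := orth _ _ Ihe Ig; rewrite /idempotent_elt !mulA.
(* Commutation at [g] of [h] with the idempotent [h * e]. *)
have gheg : g * h * e * g = g * h * g.
  have := comm g h (h * e) Ig Ih Ihe.
  rewrite !mulA bandK // => ->.
  have -> : g * h * e * g * h * g = g * (h * e * g * h) * g by rewrite !mulA.
  by rewrite -hgh !mulA bandK.
have hghg := bandK _ _ Ih Ig.
(* The chain is [hg = h(ghg) = h(gheg) = (hgh)eg = (hegh)eg = heg]. *)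
rewrite -hghg -!mulA [g * (h * g)]mulA -gheg !mulA.
by rewrite hgh heg_idem.
Qed.

(** From [a = s * (a * a)] and [a = a * a * t] one gets [s * a = a * t], the identity of the group
    H-class of [a]. The form [h = a * t] ensures that every left identity of [a] also fixes [h]. *)
Lemma completely_regular_idem a : completely_regular mul ->
  exists h, [/\ idem h, a * h = a & exists t, h = a * t].
Proof.
move=> /(_ a) [La Ra].
have [s as_] : exists s, a = s * (a * a).
  (* If the multiplier is the adjoined identity, then [a] is idempotent and can itself serve as
     multiplier. *)
  case: ((La a).1 (or_introl erefl)) => [aa | //].
  by exists a; rewrite -!aa.
have [t at_] : exists t, a = a * a * t.
  case: ((Ra a).1 (or_introl erefl)) => [aa | //].
  by exists a; rewrite -!aa.
have st : s * a = a * t by rewrite {1}at_ mulA -as_.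
exists (a * t); split; last by exists t.
- by rewrite /idempotent_elt -{1}st mulA -[s * a * a]mulA -as_.
- by rewrite mulA -at_.
Qed.

End Orthogroups.

(** * Equivalent forms of the insertion identity and its extension to idempotents *)

Section ProjectionInsertion.
Variables (S : Type) (mul : S -> S -> S) (star : S -> S).
Hypothesis Smul : regular_star_semigroup mul star.
Local Notation "x * y" := (mul x y).
Local Notation "x ^*" := (star x).
Local Notation idem := (idempotent_elt mul).

Let mulA : associative mul := semigroup_assoc (rss_semigroup Smul).
Let mulKs x : x * x^* * x = x := rss_regular Smul x.
Let starK : involutive star := rss_involutive Smul.
Let starM x y : (x * y)^* = y^* * x^* := rss_antimorphism Smul x y.

Definition projection_insertion : Prop :=
  forall x y z, x * x^* * y * z = x * x^* * y * x * x^* * z.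

Lemma star_mulK x : x^* * x * x^* = x^*.
Proof. by have := mulKs x^*; rewrite starK. Qed.

Lemma idem_projection x : idem (x * x^*).
Proof. by rewrite /idempotent_elt mulA mulKs. Qed.

(** The two directions substitute [x * y] and [x^* * y] for [y]. *)
Lemma projection_insertion_left : projection_insertion <->
  forall x y z, x * y * z = x * y * x * x^* * z.
Proof.
split=> ins x y z; last by rewrite -[x * x^* * y]mulA ins !mulA.
by have := ins x (x * y) z; rewrite !mulA !mulKs.
Qed.

(** Forward, replace [x] by [x^*] and multiply by [x] on the left; backward, take for [x] the
    projection [x * x^*], which is idempotent and fixed by the involution. *)
Lemma projection_insertion_left_star : projection_insertion <->
  forall x y z, x * y * z = x * y * x^* * x * z.
Proof.
split=> ins x y z.
  have := congr1 (mul x) (ins x^* y z).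
  by rewrite starK !mulA !mulKs.
have := ins (x * x^*) y z.
by rewrite starM starK !mulA -[_ * x^* * x * x^*]mulA -mulA !mulA => ->;
  rewrite -!mulA; do 3 congr (_ * _); rewrite !mulA mulKs.
Qed.

(** The involution reverses products, so this is the mirror image of the left form. *)
Lemma projection_insertion_right : projection_insertion <->
  forall x y z, z * y * x = z * x^* * x * y * x.
Proof.
rewrite projection_insertion_left.
split=> ins x y z; apply: (can_inj starK); rewrite !starM ?starK !mulA.
- by rewrite ins starK.
- by rewrite ins starK.
Qed.

Lemma projection_insertion_right_star : projection_insertion <->
  forall x y z, z * y * x = z * x * x^* * y * x.
Proof.
rewrite projection_insertion_left_star.
split=> ins x y z; apply: (can_inj starK); rewrite !starM ?starK !mulA.
- by rewrite ins starK.
- by rewrite ins starK.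
Qed.

Lemma idem_projections e : idem e -> e * e^* * (e^* * e) = e.
Proof.
move=> Ie; rewrite mulA -[e * e^* * e^*]mulA -starM Ie.
exact: mulKs.
Qed.

Lemma projection_insertion_idem e y z : projection_insertion -> idem e ->
  e * y * z = e * y * e * z.
Proof.
move=> ins Ie.
have /projection_insertion_left ins1 := ins.
have /projection_insertion_left_star ins2 := ins.
(* Inserting [e * e^*] and then [e^* * e] between [y] and [z] assembles the factorization of [e]
   into projections. *)
have := ins2 e (y * e * e^*) z; rewrite !mulA -ins1 => ->.
by rewrite -{7}(idem_projections Ie) !mulA.
Qed.

Lemma projection_insertion_idem_dual e y z : projection_insertion -> idem e ->
  z * y * e = z * e * y * e.
Proof.
move=> ins Ie; apply: (can_inj starK); rewrite !starM !mulA.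
by apply: projection_insertion_idem => //; rewrite /idempotent_elt -starM Ie.
Qed.

(** * The insertion identity against the three structural properties *)

Lemma green_L_square a s : a = s * (a * a) -> green_L mul a (a * a).
Proof.
move=> as_ x; split=> [] [->|[t ->]]; right.
- by exists s.
- by exists (t * s); rewrite {1}as_ mulA.
- by exists a.
- by exists (t * a); rewrite mulA.
Qed.

Lemma green_R_square a t : a = a * a * t -> green_R mul a (a * a).
Proof.
move=> at_ x; split=> [] [->|[s ->]]; right.
- by exists t.
- by exists (t * s); rewrite {1}at_ -!mulA.
- by exists a.
- by exists (a * s); rewrite mulA.
Qed.

Lemma projection_insertion_completely_regular :
  projection_insertion -> completely_regular mul.
Proof.
move=> ins.
have /projection_insertion_left_star insl := ins.
have left_sq a : a = a * a^* * a^* * (a * a).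
  by rewrite mulA -insl mulKs.
move=> a; split; first exact: green_L_square (left_sq a).
(* The witness is the image under the involution of the left multiplier that [left_sq] gives for
   [a^*]. *)
apply: (@green_R_square _ (a^* * a^* * a)); apply: (can_inj starK).
by rewrite !starM starK {1}(left_sq a^* ) starK !mulA.
Qed.

Lemma projection_insertion_orthodox : projection_insertion -> orthodox mul.
Proof.
move=> ins e f Ie If; rewrite /idempotent_elt mulA.
by rewrite -projection_insertion_idem // -mulA If.
Qed.

Lemma projection_insertion_locally_inverse :
  projection_insertion -> locally_inverse mul.
Proof.
move=> ins e Ie.
have el x : local_submonoid mul e x -> e * x = x.
  by case=> s ->; rewrite !mulA Ie.
have er x : local_submonoid mul e x -> x * e = x.
  by case=> s ->; rewrite -!mulA Ie.
have clos x y : local_submonoid mul e x -> local_submonoid mul e y ->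
    local_submonoid mul e (x * y).
  by move=> ex ey; exists (x * y); rewrite mulA el // -mulA er.
(* Both products equal [g * h * g]: the local identity [e] supplies the third factor that insertion
   needs, on the right for [g * h] and on the left for [h * g]. *)
have comm g h : local_submonoid mul e g -> local_submonoid mul e h ->
    idem g -> idem h -> g * h = h * g.
  move=> eg eh Ig Ih.
  rewrite -[LHS](er _ (clos _ _ eg eh)) projection_insertion_idem //.
  rewrite -mulA er // -[RHS](el _ (clos _ _ eh eg)) mulA.
  by rewrite [RHS]projection_insertion_idem_dual // el.
split.
- by exists (e * e * e); exists e.
- exact: clos.
move=> x ex.
have : local_submonoid mul e (e * x^* * e) by exists x^*.
have : semigroup_inverse mul x (e * x^* * e).
  split; first by rewrite !mulA (er x) // -mulA el // mulKs.
  rewrite !mulA -[_ * e * x]mulA (el x) // -[_ * x * e]mulA (er x) //.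
  by rewrite -!mulA; congr (_ * _); rewrite !mulA star_mulK.
move: (e * x^* * e) => y [xyx yxy] ey.
exists y; split=> // z [ez [xzx zxz]].
have Ixy : idem (x * y) by rewrite /idempotent_elt mulA xyx.
have Ixz : idem (x * z) by rewrite /idempotent_elt mulA xzx.
have Iyx : idem (y * x) by rewrite /idempotent_elt mulA yxy.
have Izx : idem (z * x) by rewrite /idempotent_elt mulA zxz.
(* Expanding [x] as [x * z * x] lets the idempotents [y * x] and [z * x] swap, after which
   [x * y * x] collapses. *)
have yx_zx : y * x = z * x.
  rewrite -{1}xzx !mulA -[y * x * z * x]mulA comm //; try exact: clos.
  by rewrite -mulA [x * (y * x)]mulA xyx.
have xy_xz : x * y = x * z.
  rewrite -{1}xzx -mulA comm //; try exact: clos.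
  by rewrite mulA xyx.
by rewrite -yxy yx_zx -mulA xy_xz mulA.
Qed.

Lemma orthogroup_projection_insertion :
  completely_regular mul -> orthodox mul -> locally_inverse mul ->
  projection_insertion.
Proof.
move=> creg orth linv x y z.
rewrite -[_ * y * x * _]mulA.
move: (x * x^* ) (idem_projection x) => e Ie.
have [h [Ih eyh [t ht]]] := completely_regular_idem mulA (e * y) creg.
have eh : e * h = h by rewrite ht !mulA Ie.
have hg := orthodox_locally_inverse_insert mulA orth linv Ie Ih
  (idem_projection z) eh.
rewrite -{1}eyh -{1}(mulKs z).
by rewrite -(mulA _ h) [h * _]mulA hg -!mulA [z * _]mulA mulKs !mulA eyh.
Qed.

Lemma projection_insertionP : projection_insertion <->
  completely_regular mul /\ orthodox mul /\ locally_inverse mul.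
Proof.
split=> [ins | [creg [orth linv]]].
  split; first exact: projection_insertion_completely_regular.
  split; first exact: projection_insertion_orthodox.
  exact: projection_insertion_locally_inverse.
exact: orthogroup_projection_insertion.
Qed.

(** * The four semibrace laws as insertion identities *)

Section Semibraces.
Variable add : S -> S -> S.

Lemma left_semibrace_mulP : (forall a b, add a b = a * b) ->
  left_regular_star_semibrace add mul star <-> projection_insertion.
Proof.
move=> addE; rewrite projection_insertion_left.
split=> [[_ _ law] x y z | ins].
  by have := law x y z; rewrite !addE !mulA.
split=> // [|x y z]; last by rewrite !addE !mulA ins.
split; first exact: semigroup_nonempty (rss_semigroup Smul).
by move=> a b c; rewrite !addE mulA.
Qed.

Lemma right_semibrace_mulP : (forall a b, add a b = a * b) ->
  right_regular_star_semibrace add mul star <-> projection_insertion.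
Proof.
move=> addE; rewrite projection_insertion_right.
split=> [[_ _ law] x y z | ins].
  by have := law x y z; rewrite !addE !mulA.
split=> // [|x y z]; last by rewrite !addE !mulA ins.
split; first exact: semigroup_nonempty (rss_semigroup Smul).
by move=> a b c; rewrite !addE mulA.
Qed.

(** Reversing the addition swaps [y] with [z] and turns the inserted [x * x^*] into [x^* * x], hence
    the starred form of the identity. *)
Lemma left_semibrace_oppP : (forall a b, add a b = b * a) ->
  left_regular_star_semibrace add mul star <-> projection_insertion.
Proof.
move=> addE; rewrite projection_insertion_left_star.
split=> [[_ _ law] x y z | ins].
  by have := law x z y; rewrite !addE !mulA.
split=> // [|x y z]; last by rewrite !addE !mulA ins.
split; first exact: semigroup_nonempty (rss_semigroup Smul).
by move=> a b c; rewrite !addE mulA.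
Qed.

Lemma right_semibrace_oppP : (forall a b, add a b = b * a) ->
  right_regular_star_semibrace add mul star <-> projection_insertion.
Proof.
move=> addE; rewrite projection_insertion_right_star.
split=> [[_ _ law] x y z | ins].
  by have := law x z y; rewrite !addE !mulA => <-.
split=> // [|x y z]; last by rewrite !addE !mulA ins.
split; first exact: semigroup_nonempty (rss_semigroup Smul).
by move=> a b c; rewrite !addE mulA.
Qed.

End Semibraces.
End ProjectionInsertion.

Theorem proposition3p3 (S : Type) (mul : S -> S -> S) (star : S -> S)
    (add oplus : S -> S -> S)
    (Smul : regular_star_semigroup mul star)
    (addE : forall a b, add a b = mul a b)
    (oplusE : forall a b, oplus a b = mul b a) :
  [<-> left_regular_star_semibrace add mul star;
       right_regular_star_semibrace add mul star;
       two_sided_regular_star_semibrace add mul star;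
       completely_regular mul /\ orthodox mul /\ locally_inverse mul]
  /\
  [<-> left_regular_star_semibrace oplus mul star;
       right_regular_star_semibrace oplus mul star;
       two_sided_regular_star_semibrace oplus mul star;
       completely_regular mul /\ orthodox mul /\ locally_inverse mul].
Proof.
have insP := projection_insertionP Smul.
have lP := left_semibrace_mulP Smul addE.
have rP := right_semibrace_mulP Smul addE.
have loP := left_semibrace_oppP Smul oplusE.
have roP := right_semibrace_oppP Smul oplusE.
split; tfae.
- by rewrite lP rP.
- by rewrite /two_sided_regular_star_semibrace lP rP.
- by case=> + _; rewrite lP insP.
- by rewrite lP insP.
- by rewrite loP roP.
- by rewrite /two_sided_regular_star_semibrace loP roP.
- by case=> + _; rewrite loP insP.
- by rewrite loP insP.
Qed.
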